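(* Let $\mu>-1$ and $b>a>0$. Then the probability distribution with support $[0,\infty)$ and probability density function $$\psi_{\mu,a,b}(x)=\frac{\sqrt{\pi}\,(b^2-a^2)^{\mu+\frac{3}{2}}}{2b\,(2a)^{\mu}\,\Gamma\left(\mu+\frac{3}{2}\right)}\,x^{\mu+1}e^{-bx}I_{\mu}(ax),\qquad x>0,$$ is infinitely divisible.
   Context: $I_\mu$ is the modified Bessel function of the first kind of order $\mu$, and $\Gamma$ is the Euler gamma function. A probability distribution $\nu$ on $[0,\infty)$ is infinitely divisible if for every $n\in\mathbb{N}$ there is a probability distribution $\nu_n$ on $[0,\infty)$ with $\int_0^\infty e^{-xt}d\nu(t)=\left[\int_0^\infty e^{-xt}d\nu_n(t)\right]^n$ for all $x>0$. *)

(* Defs.v *)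
From HB Require Import structures.
From mathcomp Require Export all_boot all_order all_algebra.
From mathcomp Require Export all_classical all_reals all_analysis.

Set Implicit Arguments.
Unset Strict Implicit.
Unset Printing Implicit Defensive.
Import Order.TTheory GRing.Theory Num.Theory.
Import numFieldNormedType.Exports.

Local Open Scope classical_set_scope.
Local Open Scope ring_scope.

(* Euler's integral converges, and is the gamma function, exactly for s > 0. *)
Definition Gamma (R : realType) (s : R) : R :=
  \int[lebesgue_measure]_(t in `]0, +oo[) (t `^ (s - 1) * expR (- t)).

(* For m > -1 every Gamma argument in the series is positive, so that Euler's
   integral applies; z is meant to be positive, powR being the power of a
   positive base. *)
Definition besselI (R : realType) (m z : R) : R :=
  limn (series (fun k : nat =>
    (z / 2) `^ (2 * k%:R + m) / (k`!%:R * Gamma (k%:R + m + 1)))).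

(* The formula for the density, meaningful for x > 0 only. *)
Definition psi (R : realType) (m a b x : R) : R :=
  Num.sqrt pi * (b ^+ 2 - a ^+ 2) `^ (m + 3 / 2)
    / (2 * b * (2 * a) `^ m * Gamma (m + 3 / 2))
  * x `^ (m + 1) * expR (- (b * x)) * besselI m (a * x).

Definition has_pdf (R : realType) (nu : probability (measurableTypeR R) R)
    (f : R -> R) : Prop :=
  [/\ measurable_fun [set: measurableTypeR R] f,
      forall x : R, 0 <= f x &
      forall A : set (measurableTypeR R), measurable A ->
        nu A = (\int[lebesgue_measure]_(x in A) (f x)%:E)%E].

(* The smallest closed set of full measure. *)
Definition msupport (R : realType) (nu : probability (measurableTypeR R) R)
    : set R :=
  [set x | forall U : set R, open U -> U x -> (0 < nu U)%E].

Definition on_nonneg (R : realType) (nu : probability (measurableTypeR R) R)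
    : Prop := nu `[0, +oo[%classic = 1%E.

(* Real-valued: for nu a probability and 0 < x the integrand is in [0, 1]. *)
Definition laplace (R : realType) (nu : probability (measurableTypeR R) R)
    (x : R) : R :=
  \int[nu]_(t in `[0, +oo[) expR (- (x * t)).

Definition infinitely_divisible (R : realType)
    (nu : probability (measurableTypeR R) R) : Prop :=
  on_nonneg nu /\
  forall n : nat, (0 < n)%N ->
    exists nu_n : probability (measurableTypeR R) R,
      on_nonneg nu_n /\
      forall x : R, 0 < x -> laplace nu x = laplace nu_n x ^+ n.

(* Main.v *)
From HB Require Import structures.
Require Import Defs.
From mathcomp Require Import all_boot all_order all_algebra.
From mathcomp Require Import all_classical all_reals all_analysis.
From mathcomp Require Import measurable_realfun ring lra.
Import Order.TTheory GRing.Theory Num.Theory.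
Import numFieldNormedType.Exports.
Local Open Scope classical_set_scope.
Local Open Scope ring_scope.

(** For [p > a > 0] and [c > 0] put [s = c (2 mu + 2)] and [al = c (mu + 3/2)].
    Expanding [(1 - a^2/p^2)^(-al)] in powers of [a^2/p^2] exhibits
    [p^(-s) (1 - a^2/p^2)^(-al)] as a series with positive coefficients in the
    powers [p^(-s-2k)], that is, as the Laplace transform at [p - b] of a positive
    mixture of the densities [x^(s+2k-1) e^(-bx)].  After normalization this is
    a probability on the half line whose Laplace transform is the [c]-th power
    of the one for [c = 1].  By Legendre's duplication formula the mixture for
    [c = 1] is [psi], and the [n]-th convolution root is the one for [c = 1/n]. *)

(** With [p = b + x], the transform whose roots are sought is [(p/b) * ((b^2 - a^2) / (p^2 -
    a^2))^(mu + 3/2)]. The factor [p/b] increases with [x], so no positive power of it is the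
    Laplace transform of a probability on the half line, and the two factors cannot be treated
    separately. The remedy is to pull [p^(-2 mu - 3)] out of the second factor: it absorbs [p] and
    leaves the exponent [2 mu + 2], which is positive exactly when [mu > -1]. Positivity of the
    mixture rests only on that of [s] and [al], which survives multiplication by any [c > 0]; the
    density and its roots are thus instances of one construction. The duplication formula enters
    when coefficients are compared: the mixture carries [Gamma(mu + 3/2 + k) / Gamma(2 mu + 2 +
    2k)], the Bessel series [1 / Gamma(k + mu + 1)]. *)

(** * Real powers and exponential decay *)

Section powR_facts.
Context {R : realType}.
Implicit Types p x y r s t l : R.

Lemma gt0_powRD (x r s : R) : 0 < x -> x `^ (r + s) = x `^ r * x `^ s.
Proof. by move=> x0; rewrite powRD// (gt_eqF x0) implybT. Qed.

Lemma powRV x r : 0 < x -> x^-1 `^ r = (x `^ r)^-1.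
Proof. by move=> x0; rewrite -[x^-1]powR_inv1 ?(ltW x0)// -powRrM mulN1r powRN. Qed.

(** Concavity of [ln]: with [w] the weighted mean of [1] and [y], the bound [ln u <= u - 1] at
    [u = y / w] and [u = 1 / w], averaged with weights [l] and [1 - l], has right-hand side [0]. *)
Lemma powR_le_affine y l : 0 < y -> 0 <= l <= 1 -> y `^ l <= 1 - l + l * y.
Proof.
move=> y0 /andP[l0 l1]; set w := 1 - l + l * y.
have w0 : 0 < w.
  rewrite /w; have [->|ln0] := eqVneq l 0; first by lra.
  rewrite ltr_wpDl ?subr_ge0// mulr_gt0// lt0r ln0 l0//.
have tangent (u : R) : 0 < u -> ln u <= u - 1.
  by move=> u0; rewrite -[X in ln X](subrK 1) addrC le_ln1Dx// ltrBrDr addNr.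
have h1 := tangent _ (divr_gt0 y0 w0).
have h2 := tangent w^-1; rewrite invr_gt0 in h2; have {}h2 := h2 w0.
rewrite lnV ?posrE// in h2; rewrite ln_div ?posrE// in h1.
rewrite /powR gt_eqF// -(lnK w0) ler_expR.
have e : l * (y / w - 1) + (1 - l) * (w^-1 - 1) = 0.
  rewrite /w; field; by rewrite gt_eqF.
have l1' : 0 <= 1 - l by rewrite subr_ge0.
have := lerD (ler_wpM2l l0 h1) (ler_wpM2l l1' h2); rewrite e; lra.
Qed.

Lemma measurable_expRM p (D : set R) : measurable_fun D (fun t : R => expR (- (p * t))).
Proof.
apply: measurable_funTS; apply: measurableT_comp => //.
by apply: measurableT_comp => //; exact: mulrl_measurable.
Qed.

Lemma measurable_powR_expR p s (D : set R) :
  measurable_fun D (fun t : R => t `^ s * expR (- (p * t))).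
Proof.
apply: measurable_funM; last exact: measurable_expRM.
by apply: measurable_funTS; exact: measurable_powR.
Qed.

Lemma derive_expRM p (t : R) :
  is_derive t 1 (fun t : R => - expR (- (p * t))) (p * expR (- (p * t))).
Proof.
apply: is_derive_eq.
by rewrite !scaler1 /GRing.scale/= mulrN opprK mulrC.
Qed.

Lemma powR_expR_cvgy p s : 0 < p ->
  (t `^ s * expR (- (p * t))) @[t --> +oo] --> (0 : R).
Proof.
move=> p0.
have [N sN] : exists N : nat, s <= N%:R.
  by exists (Num.bound `|s|); exact: le_trans (ler_norm _) (ltW (archi_boundP (normr_ge0 _))).
(* The term of degree [N.+1] of the exponential series gives [expR (p * t) >= t ^+ N.+1 / C]; this
   is one degree above [t ^+ N], so the function is at most [C / t] once [t >= 1]. *)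
pose C := p ^- N.+1 * N.+1`!%:R.
have C0 : 0 < C by rewrite mulr_gt0 ?invr_gt0 ?exprn_gt0 ?ltr0n ?fact_gt0.
apply: (@squeeze_cvgr _ _ _ _ (fun=> 0) (fun t => C * t^-1)).
- near=> t.
  have t1 : 1 <= t by near: t; exact: nbhs_pinfty_ge.
  have t0 : 0 < t by exact: lt_le_trans t1.
  rewrite mulr_ge0 ?powR_ge0 ?expR_ge0//=.
  rewrite expRN ler_pdivrMr ?expR_gt0//.
  apply: (@le_trans _ _ (t ^+ N)).
    by rewrite -powR_mulrn ?(ltW t0)// ler_powR.
  have := @expR_ge1Dxn _ (p * t) N (ltW (mulr_gt0 p0 t0)).
  move=> /(le_trans (ltW (ltr_pwDl ltr01 (lexx _)))) h.
  apply: le_trans (ler_wpM2l _ h); last by rewrite mulr_ge0 ?invr_ge0 ?(ltW C0) ?(ltW t0).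
  rewrite le_eqVlt; apply/orP; left; apply/eqP.
  rewrite /C exprMn (exprS t).
  have : N.+1`!%:R != 0 :> R by rewrite pnatr_eq0 -lt0n fact_gt0.
  have : p ^+ N.+1 != 0 by rewrite expf_neq0// gt_eqF.
  move: (p ^+ N.+1) (N.+1`!%:R : R) => x y x0 y0.
  by field; rewrite x0 y0 gt_eqF.
- exact: cvg_cst.
- rewrite -(mulr0 C); apply: cvgMr.
  by apply/gtr0_cvgV0; [exact: nbhs_pinfty_gt|exact: cvg_id].
Unshelve. all: end_near. Qed.

Lemma powR_expR_cvg0 p s : 0 < s ->
  (t `^ s * expR (- (p * t))) @[t --> 0^'+] --> (0 : R).
Proof.
move=> s0; rewrite -[X in _ --> X](mul0r (expR (- (p * 0)))).
apply: (cvgM (@powR_cvg0 _ s s0)).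
apply: cvg_at_right_filter.
suff : continuous (fun t : R => expR (- (p * t))) by exact.
move=> t; apply: differentiable_continuous; apply/derivable1_diffP.
exact: ex_derive.
Qed.

End powR_facts.

(** * Limits, series and integrals over the half line *)

Section series_and_integrals.
Context {R : realType}.
Local Notation mu := (@lebesgue_measure R).

Lemma cvg_invn2 : (n.+2%:R^-1 : R) @[n --> \oo] --> (0 : R).
Proof.
by have := @cvg_harmonic R; rewrite -(cvg_shiftS (@harmonic R)).
Qed.

(** If [c > 1], some [x = z + N] satisfies [x >= 1] and [(c - 1) * x > 3], so that
    [(c - 1) * x^2 > 3 * x >= 2 * x + 1], against [c * x^2 <= (x + 1)^2]. This turns the asymptotic
    comparison of duplication ratios into an exact inequality. *)
Lemma le1_of_sqr_ratio (c z : R) : 0 < z ->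
  (forall n, c <= ((z + n%:R + 1) / (z + n%:R)) ^+ 2) -> c <= 1.
Proof.
move=> z0 h; rewrite leNgt; apply/negP => c1.
pose N := (Num.bound (3 / (c - 1))).+1.
have x1 : 1 <= z + N%:R by rewrite -[leLHS]add0r lerD ?ler1n// ltW.
have xc : 3 / (c - 1) < z + N%:R.
  apply: (@lt_trans _ _ N%:R); last by rewrite ltrDr.
  apply: lt_trans (archi_boundP _) _; last by rewrite ltr_nat.
  by rewrite divr_ge0// subr_ge0 ltW.
move: (h N) xc x1; move: (z + N%:R) => x hx.
rewrite ltr_pdivrMr ?subr_gt0// => xc x1.
have x0 : 0 < x by exact: lt_le_trans x1.
move: hx; rewrite expr_div_n ler_pdivlMr ?exprn_gt0// => hx.
have : x * (c - 1) * x <= 2 * x + 1 by rewrite expr2 in hx; nra.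
nra.
Qed.

Lemma nneseries_limn (u : R^nat) : cvgn (series u) ->
  (\sum_(k <oo) (u k)%:E)%E = (limn (series u))%:E.
Proof.
move=> cu; rewrite -EFin_lim//.
by apply/congr_lim/funext => n /=; rewrite /series/= sumEFin.
Qed.

Lemma nneseries_expR (x : R) : (\sum_(k <oo) (x ^+ k / k`!%:R)%:E)%E = (expR x)%:E.
Proof. by rewrite nneseries_limn//; exact: is_cvg_series_exp_coeff. Qed.

(** A vanishing integral would make [f] zero almost everywhere on [D], and []u, v[] would lie in a
    null set. *)
Lemma integral_gt0_itv (f : R -> \bar R) (D : set R) (u v : R) :
  measurable D -> measurable_fun D f -> (forall x, D x -> (0 <= f x)%E) ->
  u < v -> `]u, v[%classic `<=` D -> (forall x, x \in `]u, v[ -> (0 < f x)%E) ->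
  (0 < \int[mu]_(x in D) f x)%E.
Proof.
move=> mD mf f0 uv uvD fgt0.
rewrite lt0e integral_ge0// andbT; apply/eqP => f_eq0.
have : ae_eq mu D f (cst 0%E).
  apply/ae_eq_integral_abs => //; rewrite -[RHS]f_eq0.
  by apply: eq_integral => x /[!inE] Dx; rewrite gee0_abs ?f0.
move=> [N [mN N0 sub]].
have : (mu `]u, v[%classic <= mu N)%E.
  apply: le_measure; rewrite ?inE//.
  move=> x /= xuv; apply: sub => /=; apply/not_implyP; split; first exact: uvD.
  by apply/eqP; rewrite gt_eqF// fgt0.
by rewrite N0 lebesgue_measure_itv/= lte_fin uv -EFinB lee_fin leNgt subr_gt0 uv.
Qed.

Section itv0y.
Variable k : nat -> nat.
Hypotheses (nd_k : {homo k : m n / (m <= n)%N}) (lt1k : forall n, (n < k n)%N).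

Let k0 n : 0 < (k n)%:R :> R.
Proof. by rewrite ltr0n (leq_ltn_trans _ (lt1k n)). Qed.

Lemma bigcup_itv0y :
  \bigcup_n `[((k n)%:R^-1 : R), (k n)%:R]%classic = `]0, +oo[%classic.
Proof.
apply/seteqP; split => [x [n _]|x] /=; rewrite !in_itv/= ?andbT.
  by move=> /andP[+ _]; apply: lt_le_trans; rewrite invr_gt0.
move=> x0; pose N := maxn (Num.bound x) (Num.bound x^-1).
have bN y : 0 < y -> (Num.bound y <= N)%N -> y <= (k N)%:R.
  move=> y0 yN; apply: ltW; apply: lt_le_trans (archi_boundP (ltW y0)) _.
  by rewrite ler_nat; apply: (leq_trans yN); exact: ltnW.
exists N => //=; rewrite in_itv/=; apply/andP; split.
  rewrite -[leRHS]invrK lef_pV2 ?posrE ?invr_gt0//.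
  by apply: bN; rewrite ?invr_gt0// leq_maxr.
by apply: bN => //; rewrite leq_maxl.
Qed.

(** Monotone convergence; it lets integration by parts and the substitution [t = u^2] be done on
    compact intervals away from the singularity at [0]. The bounds are a parameter because that
    substitution matches [[1/k, k]] with [[1/k^2, k^2]]. *)
Lemma cvg_integral_itv0y (f : R -> R) :
  measurable_fun `](0 : R), +oo[ f -> {in `](0 : R), +oo[, forall x, 0 <= f x} ->
  (\int[mu]_(x in `[((k n)%:R^-1)%R, (k n)%:R%R]) (f x)%:E)%E @[n --> \oo] -->
  (\int[mu]_(x in `]0%R, +oo[) (f x)%:E)%E.
Proof.
move=> mf f0; rewrite -bigcup_itv0y.
have sub n : `[((k n)%:R^-1 : R), (k n)%:R]%classic `<=` `]0, +oo[.
  by rewrite -bigcup_itv0y => x ?; exists n.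
apply: ge0_nondecreasing_set_cvg_integral => //.
- move=> m n mn; apply/subsetPset; apply: subset_itv.
    by rewrite bnd_simp lef_pV2 ?posrE// ler_nat nd_k.
  by rewrite bnd_simp ler_nat nd_k.
- by move=> n; apply/measurable_EFinP; exact: measurable_funS mf.
- by move=> n x /sub /= x0; rewrite lee_fin f0.
Qed.

End itv0y.

End series_and_integrals.

(** * The gamma function *)

Section egamma.
Context {R : realType}.
Implicit Types p s t : R.
Local Notation mu := (@lebesgue_measure R).

(* Extended-real valued, so that the recurrence below needs no integrability
   and can be used to prove it. *)
Definition egamma p s : \bar R :=
  (\int[mu]_(t in `]0%R, +oo[) (t `^ (s - 1) * expR (- (p * t)))%:E)%E.

Lemma egamma_ge0 p s : (0 <= egamma p s)%E.
Proof. by apply: integral_ge0 => t _; rewrite lee_fin mulr_ge0 ?powR_ge0 ?expR_ge0. Qed.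

Lemma egammaZl c p s : 0 <= c ->
  (c%:E * egamma p s =
   \int[mu]_(t in `]0%R, +oo[) (c * (t `^ (s - 1) * expR (- (p * t))))%:E)%E.
Proof.
move=> c0; rewrite /egamma -ge0_integralZl//.
- by apply/measurable_EFinP; exact: measurable_powR_expR.
- by move=> x _; rewrite lee_fin mulr_ge0 ?powR_ge0 ?expR_ge0.
Qed.

(* Integration by parts on [[1/(n+2), n+2]]; the boundary terms vanish in the limit. *)
Lemma egammaS p s : 0 < p -> 0 < s ->
  (p%:E * egamma p (s + 1) = s%:E * egamma p s)%E.
Proof.
move=> p0 s0.
have m1 (c : R) r : measurable_fun `](0 : R), +oo[
    (fun t => c * (t `^ r * expR (- (p * t)))).
  by apply: measurable_funM => //; exact: measurable_powR_expR.
have ge0 (c : R) r : 0 < c ->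
    {in `](0 : R), +oo[, forall x, 0 <= c * (x `^ r * expR (- (p * x)))}.
  by move=> c0 x _; rewrite !mulr_ge0 ?powR_ge0 ?expR_ge0// ltW.
rewrite !egammaZl ?ltW//.
pose S2 n := n.+2.
have ndS : {homo S2 : m n / (m <= n)%N} by [].
have ltS n : (n < S2 n)%N by exact: leqW.
have := cvg_integral_itv0y S2 ndS ltS _ (m1 p (s + 1 - 1)) (ge0 _ _ p0).
set U := (X in X = _) => cU.
have := cvg_integral_itv0y S2 ndS ltS _ (m1 s (s - 1)) (ge0 _ _ s0).
set V := (X in _ = X) => cV.
pose D n : R := - (n.+2%:R `^ s * expR (- (p * n.+2%:R)))
   + (n.+2%:R^-1 `^ s * expR (- (p * n.+2%:R^-1))).
have cD : (D n)%:E @[n --> \oo] --> 0%E.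
  apply: cvg_EFin; first by near=> n.
  rewrite -[X in _ --> X]addr0 -{1}oppr0; apply: cvgD.
    apply: cvgN.
    apply: (cvg_comp _ _ _ (powR_expR_cvgy p s p0)) => /=.
    by have := @cvgr_idn R; rewrite -cvg_shiftS -cvg_shiftS.
  move: (powR_expR_cvg0 p s s0) => /cvg_at_rightP; apply.
  by split => [n|]; [rewrite invr_gt0|exact: cvg_invn2].
have key n : (\int[mu]_(x in `[(n.+2%:R^-1)%R, n.+2%:R%R])
    (p * (x `^ (s + 1 - 1) * expR (- (p * x))))%:E = (D n)%:E +
   \int[mu]_(x in `[(n.+2%:R^-1)%R, n.+2%:R%R])
    (s * (x `^ (s - 1) * expR (- (p * x))))%:E)%E.
  have pos x : x \in `[(n.+2%:R^-1 : R), n.+2%:R] -> 0 < x.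
    by rewrite in_itv/= => /andP[+ _]; apply: lt_le_trans; rewrite invr_gt0.
  have poso x : x \in `](n.+2%:R^-1 : R), n.+2%:R[ -> 0 < x.
    by move=> /subset_itv_oo_cc; exact: pos.
  have lt2 : n.+2%:R^-1 < n.+2%:R :> R.
    by rewrite (@lt_trans _ _ 1)// ?invf_lt1// ltr1n.
  have dexp (t : R) : derivable (fun t : R => p * expR (- (p * t))) t 1.
    exact: ex_derive.
  have dpow (r t : R) : 0 < t -> derivable (fun t : R => t `^ r) t 1.
    by move=> t0; apply: derivable_powR; rewrite in_itv/= t0.
  have cpow (t : R) : 0 < t -> {for t, continuous (fun t : R => t `^ s)}.
    move=> t0; apply: differentiable_continuous; apply/derivable1_diffP.
    exact: dpow.
  have cexp (t : R) : {for t, continuous (fun t : R => - expR (- (p * t)))}.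
    apply: differentiable_continuous; apply/derivable1_diffP.
    exact: ex_derive.
  have -> : (\int[mu]_(x in `[(n.+2%:R^-1)%R, n.+2%:R%R])
      (p * (x `^ (s + 1 - 1) * expR (- (p * x))))%:E =
      \int[mu]_(x in `[(n.+2%:R^-1)%R, n.+2%:R%R])
      (x `^ s * (p * expR (- (p * x))))%:E)%E.
    by apply: eq_integral => x _; rewrite addrK mulrCA.
  rewrite (@integration_by_parts R (fun t => t `^ s)
    (fun t => - expR (- (p * t))) (fun t => s * t `^ (s - 1))
    (fun t => p * expR (- (p * t))) _ _ lt2).
  - rewrite /D; congr (_ + _)%E.
      by congr (_%:E); rewrite !mulrN opprK.
    under eq_integral do rewrite mulrN EFinN -mulrA.
    rewrite integral_ge0N ?oppeK// => x /pos x0; rewrite lee_fin.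
    by rewrite !mulr_ge0 ?powR_ge0 ?expR_ge0// ltW.
  - apply: derivable_within_continuous => x xI; have x0 := pos _ xI.
    by apply: derivableM; [exact: derivable_cst|exact: dpow].
  - split => [x xI||]; first exact: dpow (poso _ xI).
      apply: cvg_at_right_filter; apply: cpow; rewrite invr_gt0//.
    by apply: cvg_at_left_filter; exact: cpow.
  - by move=> x xI; apply: powR_derive1; rewrite in_itv/= (poso _ xI).
  - by apply: derivable_within_continuous => x _; exact: dexp.
  - split => [x _||]; first exact: ex_derive.
      by apply: cvg_at_right_filter; exact: cexp.
    by apply: cvg_at_left_filter; exact: cexp.
  - by move=> x _; rewrite derive1E; have [_ ->] := derive_expRM p x.
have cDV : ((D n)%:E + \int[mu]_(x in `[(n.+2%:R^-1)%R, n.+2%:R%R])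
    (s * (x `^ (s - 1) * expR (- (p * x))))%:E)%E @[n --> \oo] --> (0 + V)%E.
  exact: cvgeD.
move: cU; under eq_fun do rewrite key.
by move/(cvg_unique _ cDV); rewrite add0e => /(_ _)/esym; exact.
Unshelve. all: end_near. Qed.

End egamma.

Section Gamma_basics.
Context {R : realType}.
Implicit Types p s t : R.
Local Notation mu := (@lebesgue_measure R).

Lemma egamma_gt0 p s : (0 < egamma p s)%E.
Proof.
apply: (integral_gt0_itv _ _ 1 2) => //.
- by apply/measurable_EFinP; exact: measurable_powR_expR.
- by move=> x _; rewrite lee_fin mulr_ge0 ?powR_ge0 ?expR_ge0.
- by rewrite ltr1n.
- by move=> x /=; rewrite !in_itv/= andbT => /andP[+ _]; exact: lt_trans.
- move=> x; rewrite in_itv/= => /andP[x1 _].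
  by rewrite lte_fin mulr_gt0 ?expR_gt0// powR_gt0// (lt_trans _ x1).
Qed.

Lemma egamma11 : egamma 1 1 = 1%E :> \bar R.
Proof.
transitivity (\int[mu]_(t in `[0%R, +oo[) (1 * expR (- (1 * t)))%:E)%E.
  rewrite -integral_itv_obnd_cbnd//.
    by apply: eq_integral => x _; rewrite subrr powRr0.
  by apply/measurable_EFinP; apply: measurable_funM => //; exact: measurable_expRM.
have dexp t : derivable (fun t : R => expR (- (1 * t))) t 1 by exact: ex_derive.
rewrite (@ge0_continuous_FTC2y _ _ (fun t => - expR (- (1 * t))) _ 0).
- by rewrite mulr0 oppr0 expR0 EFinN oppeK add0e.
- by move=> x _; rewrite mul1r expR_ge0.
- apply: derivable_within_continuous => x _.
  by apply: derivableM; [exact: derivable_cst|exact: dexp].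
- rewrite -[X in _ --> X]oppr0; apply: cvgN.
  by under eq_fun do rewrite mul1r; exact: cvgr_expR.
- by move=> x _; exact: ex_derive.
- suff h : {for 0, continuous (fun t : R => - expR (- (1 * t)))}.
    by apply: cvg_at_right_filter; exact: h.
  by apply: differentiable_continuous; apply/derivable1_diffP; exact: ex_derive.
- by move=> x _; rewrite derive1E; have [_ ->] := derive_expRM 1 x.
Qed.

Lemma egamma1_natS n : (egamma 1 n.+1%:R < +oo :> \bar R)%E.
Proof.
elim: n => [|n ih]; first by rewrite egamma11 ltry.
have := @egammaS R 1 n.+1%:R ltr01 (ltr0Sn _ _).
rewrite mul1e natr1 => ->; rewrite lte_mul_pinfty//.
Qed.

(** The recurrence is read backwards: at [s + 1] the integrand has the factor [t^s], which is not
    singular at [0] and is at most [1 + t^N] for a natural [N >= s]; these two terms give the finite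
    values at [1] and [N.+1]. *)
Lemma egamma1_lty s : 0 < s -> (egamma 1 s < +oo)%E.
Proof.
move=> s0.
suff : (s%:E * egamma 1 s < +oo)%E.
  case: (egamma 1 s) (egamma_ge0 1 s) => [r _ _||]; rewrite ?ltry//.
  by rewrite gt0_muley// lte_fin.
rewrite -(egammaS 1 s ltr01 s0) mul1e.
have [N sN] : exists N : nat, s <= N%:R.
  by exists (Num.bound `|s|); exact: le_trans (ler_norm _) (ltW (archi_boundP (normr_ge0 _))).
have ge0 (r x : R) : (0 <= (x `^ r * expR (- (1 * x)))%:E)%E.
  by rewrite lee_fin mulr_ge0 ?powR_ge0 ?expR_ge0.
have mf (r : R) : measurable_fun `](0 : R), +oo[ (fun x : R => (x `^ r * expR (- (1 * x)))%:E).
  by apply/measurable_EFinP; exact: measurable_powR_expR.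
apply: (@le_lt_trans _ _ (egamma 1 1 + egamma 1 N.+1%:R)%E); last first.
  by rewrite lte_add_pinfty// ?egamma11 ?ltry// egamma1_natS.
rewrite /egamma -ge0_integralD//; [|exact: mf|exact: mf].
apply: ge0_le_integral => //.
- exact: mf.
- by apply: emeasurable_funD; exact: mf.
move=> x /=; rewrite in_itv/= andbT => x0.
rewrite -EFinD lee_fin -mulrDl ler_wpM2r ?expR_ge0//.
rewrite addrK subrr powRr0 -natr1 addrK.
have [x1|x1] := leP x 1.
  apply: (@le_trans _ _ 1); last by rewrite lerDl powR_ge0.
  have -> : 1 = 1 `^ s :> R by rewrite powR1.
  by rewrite ge0_ler_powR ?nnegrE ?(ltW s0) ?(ltW x0).
by rewrite (@le_trans _ _ (x `^ N%:R))// ?lerDr// ler_powR// ltW.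
Qed.

Lemma egamma1E s : 0 < s -> egamma 1 s = (Gamma s)%:E.
Proof.
move=> s0; rewrite /Gamma /Rintegral.
have -> : (\int[mu]_(t in `]0%R, +oo[) (t `^ (s - 1) * expR (- t))%:E)%E = egamma 1 s.
  by apply: eq_integral => x _; rewrite mul1r.
by rewrite fineK// ge0_fin_numE ?egamma_ge0// egamma1_lty.
Qed.

Local Opaque Gamma.

Lemma Gamma_gt0 s : 0 < s -> 0 < Gamma s.
Proof. by move=> s0; rewrite -lte_fin -egamma1E// egamma_gt0. Qed.

Lemma GammaS s : 0 < s -> Gamma (s + 1) = s * Gamma s.
Proof.
move=> s0; apply: EFin_inj; rewrite EFinM -!egamma1E ?addr_gt0//.
by rewrite -(egammaS 1 s)// mul1e.
Qed.

Lemma Gamma1 : Gamma 1 = 1 :> R.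
Proof. by apply: EFin_inj; rewrite -egamma1E// egamma11. Qed.

(* The shift to [s + 1] makes the integrand continuous at [0], as the substitution
   theorem requires. *)
Lemma egamma_scaleS p s : 0 < p -> 0 < s ->
  egamma 1 (s + 1) = ((p `^ (s + 1))%:E * egamma p (s + 1))%E.
Proof.
move=> p0 s0.
pose G x : R := x `^ s * expR (- (1 * x)).
have dF (x : R) : is_derive x 1 (fun x => p * x) p.
  by apply: is_derive_eq; rewrite scaler1.
have F1E : (fun x => p * x)^`()%classic = cst p.
  by apply/funext => x; rewrite derive1E; exact: derive_val.
have := @increasing_ge0_integration_by_substitutiony R (fun x => p * x) G 0.
rewrite F1E mulr0 => sub.
transitivity (\int[mu]_(x in `[0%R, +oo[) (G x)%:E)%E.
  rewrite -integral_itv_obnd_cbnd//.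
    by apply: eq_integral => x _; rewrite addrK.
  apply/measurable_EFinP.
  exact: measurable_powR_expR.
rewrite sub.
- rewrite -integral_itv_obnd_cbnd//.
  rewrite /egamma -ge0_integralZl//.
  + apply: eq_integral => x; rewrite inE/= in_itv/= andbT => x0.
    rewrite -EFinM /G/= fctE/= mul1r powRM ?ltW// gt0_powRD//.
    by rewrite powRr1 ?ltW// addrK; congr EFin; ring.
  + by apply/measurable_EFinP; exact: measurable_powR_expR.
  + by move=> x _; rewrite lee_fin mulr_ge0 ?powR_ge0 ?expR_ge0.
  + by rewrite lee_fin powR_ge0.
  + apply/measurable_EFinP; apply: (@measurable_funM _ _ _ _ (G \o *%R p) (cst p)) => //.
    apply: measurable_funTS; apply: measurableT_comp => //.
    exact: measurable_powR_expR.
- by move=> x y _ _ xy; rewrite ltr_pM2l.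
- by move=> x _; exact: cvg_cst.
- exact: is_cvg_cst.
- exact: is_cvg_cst.
- split => [x _|]; first exact: ex_derive.
  by apply: cvg_at_right_filter; exact: mulrl_continuous.
- exact: gt0_cvgMry.
- apply/continuous_within_itvcyP; split.
    move=> x; rewrite in_itv/= andbT => x0.
    apply: differentiable_continuous; apply/derivable1_diffP.
    apply: derivableM; last exact: ex_derive.
    by apply: derivable_powR; rewrite in_itv/= x0.
  by rewrite {2}/G powR0 ?gt_eqF// mul0r; exact: powR_expR_cvg0.
- by move=> x _; rewrite mulr_ge0 ?powR_ge0 ?expR_ge0.
Qed.

(** The substitution gives the scaling law at [s + 1] only; the recurrence, for [p] and for [Gamma],
    brings it down to [s]. *)
Lemma egammaE p s : 0 < p -> 0 < s -> egamma p s = (p `^ (- s) * Gamma s)%:E.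
Proof.
move=> p0 s0.
have p1 : p `^ (s + 1) != 0 by rewrite gt_eqF// powR_gt0.
have E : egamma p (s + 1) = (p `^ (- (s + 1)) * Gamma (s + 1))%:E.
  rewrite EFinM -egamma1E ?addr_gt0// (egamma_scaleS p s)// muleA -EFinM.
  by rewrite powRN mulVf// mul1e.
have := egammaS p s p0 s0; rewrite E GammaS// -EFinM => /(congr1 (fun x => (s^-1)%:E * x)%E).
rewrite [in RHS]muleA -!EFinM mulVf ?gt_eqF// mul1e => <-; congr EFin.
rewrite opprD gt0_powRD// powR_inv1 ?ltW//.
by field; rewrite !gt_eqF.
Qed.

End Gamma_basics.

Section gamma_half.
Context {R : realType}.
Local Notation mu := (@lebesgue_measure R).

(* The substitution [t = u^2] in the Gaussian integral. *)
Lemma Gamma_half : Gamma (2^-1) = Num.sqrt pi :> R.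
Proof.
apply: EFin_inj; rewrite -egamma1E//.
pose k n := n.+2; pose k2 n := ((n.+2) ^ 2)%N.
have ndk : {homo k : m n / (m <= n)%N} by [].
have ltk n : (n < k n)%N by exact: leqW.
have ndk2 : {homo k2 : m n / (m <= n)%N} by move=> m n mn; rewrite leq_sqr.
have ltk2 n : (n < k2 n)%N.
  by rewrite (leq_trans (ltk n))// /k2 expnS leq_pmulr// expn_gt0.
pose g (x : R) := x `^ (2^-1 - 1) * expR (- (1 * x)).
have := cvg_integral_itv0y k2 ndk2 ltk2 g.
move=> /(_ (measurable_powR_expR _ _ _) _) cg.
have {}cg := cg (fun x _ => mulr_ge0 (powR_ge0 _ _) (expR_ge0 _)).
have mgauss : measurable_fun `](0 : R), +oo[ (fun x => 2 * gauss_fun x).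
  by apply: measurable_funM => //; apply: measurable_funTS; exact: measurable_gauss_fun.
have := cvg_integral_itv0y k ndk ltk _ mgauss.
move=> /(_ (fun x _ => mulr_ge0 (ler0n _ _) (gauss_fun_ge0 _))) c2.
suff E n : (\int[mu]_(x in `[((k2 n)%:R^-1)%R, (k2 n)%:R%R]) (g x)%:E =
    \int[mu]_(x in `[((k n)%:R^-1)%R, (k n)%:R%R]) (2 * gauss_fun x)%:E)%E.
  move: cg; under eq_fun do rewrite E.
  move=> /(cvg_unique _ c2) => /(_ _)/esym h.
  rewrite -[LHS]/(\int[mu]_(t in `]0%R, +oo[) (g t)%:E)%E h//.
  under eq_integral do rewrite EFinM.
  rewrite ge0_integralZl//.
  - rewrite integral_itv_obnd_cbnd.
      by rewrite integral0y_gauss -EFinM mulrC divfK// pnatr_eq0.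
    by apply/measurable_EFinP/measurable_funTS; exact: measurable_gauss_fun.
  - by apply/measurable_EFinP/measurable_funTS; exact: measurable_gauss_fun.
  - by move=> x _; rewrite lee_fin gauss_fun_ge0.
have k0 : 0 < (k n)%:R :> R by [].
have kV0 : 0 < (k n)%:R^-1 :> R by rewrite invr_gt0.
have pos x : x \in `[((k n)%:R^-1 : R), (k n)%:R] -> 0 < x.
  by rewrite in_itv/= => /andP[+ _]; apply: lt_le_trans.
have F1E : (fun x : R => x ^+ 2)^`()%classic = (fun x => 2 * x).
  by apply/funext => x; rewrite derive1E exp_derive expr1 /GRing.scale/= mulr1.
have c2x (x : R) : {for x, continuous (fun x : R => 2 * x)} by exact: mulrl_continuous.
have csqr (x : R) : {for x, continuous (fun x : R => x ^+ 2)} by exact: exprn_continuous.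
have := @integration_by_substitution_increasing R (fun x => x ^+ 2) g (k n)%:R^-1 (k n)%:R.
rewrite F1E exprVn -natrX => ->.
- apply: eq_integral => x /[!inE] /pos x0; congr EFin.
  rewrite fctE/= /g /gauss_fun mul1r (_ : 2^-1 - 1 = - 2^-1); last by lra.
  rewrite powRN powR12_sqrt ?sqr_ge0// sqrtr_sqr gtr0_norm//.
  by field; rewrite gt_eqF.
- by rewrite (@le_trans _ _ 1)// ?invf_le1// ler1n.
- by move=> x y /pos x0 /pos y0 xy; rewrite ltr_pXn2r// nnegrE ltW.
- by move=> x _; exact: c2x.
- apply: cvgP; apply: cvg_at_right_filter; exact: c2x.
- apply: cvgP; apply: cvg_at_left_filter; exact: c2x.
- split => [x _||]; first exact: exprn_derivable.
    by apply: cvg_at_right_filter; exact: csqr.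
  by apply: cvg_at_left_filter; exact: csqr.
- apply: derivable_within_continuous => x xI.
  apply: derivableM; last exact: ex_derive.
  apply: derivable_powR; rewrite in_itv/= andbT.
  move: xI; rewrite in_itv/= => /andP[+ _]; apply: lt_le_trans.
  by rewrite invr_gt0 ltr0n expn_gt0.
Qed.

End gamma_half.

(** * Legendre's duplication formula *)

Section duplication.
Context {R : realType}.
Implicit Types x y z l : R.
Local Notation mu := (@lebesgue_measure R).

(* Wendel's inequality, from the tangent bound for [t `^ l] at [t = x]; it replaces
   the logarithmic convexity of [Gamma] and Stirling's formula. *)
Lemma Gamma_addr_le x l : 0 < x -> 0 <= l <= 1 ->
  Gamma (x + l) <= x `^ l * Gamma x.
Proof.
move=> x0 /[dup] l01 /andP[l0 l1].
have xl0 : 0 < x + l by rewrite ltr_wpDr.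
rewrite -lee_fin -egamma1E//.
have -> : x `^ l * Gamma x = x `^ l * (1 - l) * Gamma x + x `^ l / x * l * Gamma (x + 1).
  by rewrite GammaS//; field; rewrite gt_eqF.
have c1 : 0 <= x `^ l * (1 - l) by rewrite mulr_ge0 ?powR_ge0 ?subr_ge0.
have c2 : 0 <= x `^ l / x * l by rewrite !mulr_ge0 ?invr_ge0 ?powR_ge0 ?(ltW x0).
rewrite EFinD !EFinM -!egamma1E ?addr_gt0// -!EFinM.
have mE (c r : R) : measurable_fun `](0 : R), +oo[
    (fun t => (c * (t `^ r * expR (- (1 * t))))%:E).
  by apply/measurable_EFinP; apply: measurable_funM => //; exact: measurable_powR_expR.
have E0 (r t : R) : 0 <= t `^ r * expR (- (1 * t)).
  by rewrite mulr_ge0 ?powR_ge0 ?expR_ge0.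
rewrite !egammaZl// -ge0_integralD//; first last.
- exact: mE.
- by move=> t _; rewrite lee_fin mulr_ge0.
- exact: mE.
- by move=> t _; rewrite lee_fin mulr_ge0.
apply: ge0_le_integral => //.
- by move=> t _; rewrite lee_fin.
- by apply/measurable_EFinP; exact: measurable_powR_expR.
- by apply: emeasurable_funD; exact: mE.
move=> t /=; rewrite in_itv/= andbT => t0.
rewrite -EFinD lee_fin addrK.
have tE : t `^ x = t * t `^ (x - 1).
  by rewrite mulr_powRB1// ltW.
have := powR_le_affine (t / x) l (divr_gt0 t0 x0) l01.
rewrite powRM ?invr_ge0 ?(ltW t0) ?(ltW x0)// powRV//.
rewrite ler_pdivrMr ?powR_gt0// => h.
rewrite (_ : x + l - 1 = x - 1 + l); last by ring.
rewrite gt0_powRD// tE.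
rewrite [leRHS](_ : _ = (1 - l + l * (t / x)) * x `^ l * (t `^ (x - 1) * expR (- (1 * t)))).
  rewrite [leLHS](_ : _ = t `^ l * (t `^ (x - 1) * expR (- (1 * t)))); last by ring.
  exact: ler_wpM2r.
by ring.
Qed.

(** The upper bound started at [x + l] with increment [1 - l] ends at [x + 1], hence bounds
    [x * Gamma x] in terms of [Gamma (x + l)]; the powers combine through [x^l <= (x + l)^l]. *)
Lemma Gamma_addr_ge x l : 0 < x -> 0 <= l <= 1 ->
  x * (x `^ l * Gamma x) <= (x + l) * Gamma (x + l).
Proof.
move=> x0 /andP[l0 l1].
have xl0 : 0 < x + l by rewrite ltr_wpDr.
rewrite mulrCA -(GammaS x)//.
have := Gamma_addr_le (x + l) (1 - l) xl0; rewrite subr_ge0 l1 gerBl l0 => /(_ isT).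
rewrite (_ : x + l + (1 - l) = x + 1); last by ring.
move=> /(ler_wpM2l (powR_ge0 x l)) /le_trans; apply.
rewrite mulrA ler_wpM2r ?(ltW (Gamma_gt0 _ _))//.
have e : (x + l) `^ l * (x + l) `^ (1 - l) = x + l.
  by rewrite -gt0_powRD// subrKC powRr1// ltW.
rewrite -[leRHS]e.
by rewrite ler_wpM2r ?powR_ge0// ge0_ler_powR ?nnegrE ?(ltW x0) ?(ltW xl0)// lerDl.
Qed.

(* This function has period [1], and Wendel's inequality gives
   [duplication_ratio (x + l) / duplication_ratio x --> 1] as [x --> +oo]; hence
   it is constant. *)
Definition duplication_ratio z : R :=
  2 `^ (2 * z) * Gamma z * Gamma (z + 2^-1) / Gamma (2 * z).

Lemma duplication_ratio_gt0 z : 0 < z -> 0 < duplication_ratio z.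
Proof.
by move=> z0; rewrite divr_gt0 ?mulr_gt0 ?powR_gt0 ?Gamma_gt0 ?addr_gt0 ?mulr_gt0.
Qed.

Lemma duplication_ratioS z : 0 < z -> duplication_ratio (z + 1) = duplication_ratio z.
Proof.
move=> z0; rewrite /duplication_ratio GammaS// (_ : z + 1 + 2^-1 = z + 2^-1 + 1); last by ring.
rewrite GammaS ?addr_gt0// (_ : 2 * (z + 1) = 2 * z + 1 + 1); last by ring.
have z20 : 0 < 2 * z by rewrite mulr_gt0.
rewrite !GammaS ?addr_gt0// !gt0_powRD// powRr1//.
have := Gamma_gt0 _ z20; move: (Gamma (2 * z)) => g g0.
field; rewrite !gt_eqF//= ?addr_gt0//.
Qed.

(** Wendel's bounds are applied to all three gamma values; [l <= 1/2] allows the increment [2 * l]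
    at [2 * x]. The factors [2^(2l)], [x^l], [(x + 1/2)^l] and [(2x)^(2l)] would cancel if [x + 1/2]
    were [x], and the total error stays below the squared ratio. *)
Lemma duplication_ratio_addr_bounds x l : 0 < x -> 0 <= l <= 2^-1 ->
  duplication_ratio (x + l) <= ((x + 1) / x) ^+ 2 * duplication_ratio x /\
  duplication_ratio x <= ((x + 1) / x) ^+ 2 * duplication_ratio (x + l).
Proof.
move=> x0 /andP[l0 l2].
have l01 : 0 <= l <= 1 by rewrite l0/=; lra.
have l201 : 0 <= 2 * l <= 1 by apply/andP; split; lra.
have h0 : 0 < x + 2^-1 by rewrite addr_gt0.
have x20 : 0 < 2 * x by rewrite mulr_gt0.
have xl0 : 0 < x + l by rewrite ltr_wpDr.
have A1 := Gamma_addr_le x l x0 l01; have A2 := Gamma_addr_ge x l x0 l01.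
have B1 := Gamma_addr_le _ l h0 l01; have B2 := Gamma_addr_ge _ l h0 l01.
have D1 := Gamma_addr_le _ _ x20 l201; have D2 := Gamma_addr_ge _ _ x20 l201.
have SE : (2 * x) `^ (2 * l) = 2 `^ (2 * l) * x `^ l ^+ 2.
  by rewrite powRM ?(ltW x0)// -powR_mulrn ?powR_ge0// -powRrM (mulrC l).
have PQ : (x + 2^-1) `^ l <= x `^ l * ((x + 2^-1) / x).
  have -> : (x + 2^-1) `^ l = x `^ l * ((x + 2^-1) / x) `^ l.
    by rewrite -powRM ?divr_ge0 ?(ltW x0) ?(ltW h0)// mulrC divfK ?gt_eqF.
  have h1 : 1 <= (x + 2^-1) / x by rewrite ler_pdivlMr// mul1r lerDl.
  by rewrite ler_wpM2l ?powR_ge0// ler1_powR//; case/andP: l01.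
have QP : x `^ l <= (x + 2^-1) `^ l.
  by rewrite ge0_ler_powR ?nnegrE ?(ltW x0) ?(ltW h0)// lerDl.
rewrite /duplication_ratio (_ : x + l + 2^-1 = x + 2^-1 + l); last by ring.
rewrite (mulrDr 2 x l) (gt0_powRD 2)//.
move: SE PQ QP A1 A2 B1 B2 D1 D2.
have := powR_gt0 (2 * l) (ltr0n R 2) => /=.
have := powR_gt0 (2 * x) (ltr0n R 2).
have := powR_gt0 l x0; have := powR_gt0 l h0; have := Gamma_gt0 _ x0.
have := Gamma_gt0 _ h0; have := Gamma_gt0 _ x20; have := Gamma_gt0 _ xl0.
have : 0 < Gamma (x + 2^-1 + l) by rewrite Gamma_gt0// ltr_wpDr.
have : 0 < Gamma (2 * x + 2 * l) by rewrite Gamma_gt0// ltr_wpDr// mulr_ge0.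
(* Below, [A], [B], [D] are the gamma values at [x], [x + 1/2], [2x], and the primed ones those
   after the shift; [S = (2x)^(2l)], [T = 2^(2l)], [E = 2^(2x)], [P = x^l], [Q = (x + 1/2)^l]. *)
move: (Gamma _) (Gamma _) (Gamma _) (Gamma _) (Gamma _) (Gamma _).
move: (_ `^ _) (_ `^ _) (_ `^ _) (_ `^ _) (_ `^ _) => S T E P Q.
move=> A B D A' B' D' D'0 B'0 A'0 D0 B0 A0 Q0 P0 E0 T0.
move=> -> PQ QP A1 A2 B1 B2 D1 D2.
(* Absorbs the two losses of the first inequality: [(x + 1/2) / x] from replacing [Q] by [P], and
   [(x + l) / x] from the lower bound for [D']. *)
have xh : (x + 2^-1) * (x + l) <= (x + 1) ^+ 2 by nra.
split.
  rewrite ler_pdivrMr//.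
  have h1 : E * T * A' * B' <= E * T * (P * A) * (P * ((x + 2^-1) / x) * B).
    apply: ler_pM => //; rewrite ?mulr_ge0 ?(ltW E0) ?(ltW T0) ?(ltW A'0) ?(ltW B'0)//.
      by rewrite ler_wpM2l ?mulr_ge0 ?(ltW E0) ?(ltW T0).
    by apply: (le_trans B1); rewrite ler_wpM2r ?(ltW B0).
  apply: (le_trans h1).
  have h2 : T * P ^+ 2 <= (x + l) / x * (D' / D).
    rewrite mulf_div ler_pdivlMr ?mulr_gt0//.
    move: D2; rewrite -mulrDr -!mulrA ler_pM2l// => D2; lra.
  rewrite [leLHS](_ : _ = E * A * B * ((x + 2^-1) / x) * (T * P ^+ 2)); last by ring.
  have c0 : 0 <= E * A * B.
    by rewrite !mulr_ge0 ?(ltW E0) ?(ltW A0) ?(ltW B0).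
  have c1 : 0 <= E * A * B * ((x + 2^-1) / x).
    by rewrite mulr_ge0// divr_ge0 ?(ltW x0) ?(ltW h0).
  apply: (le_trans (ler_wpM2l c1 h2)).
  rewrite [leLHS](_ : _ = (E * A * B * D' / D / x ^+ 2) * ((x + 2^-1) * (x + l))); last first.
    by field; rewrite !gt_eqF.
  rewrite [leRHS](_ : _ = (E * A * B * D' / D / x ^+ 2) * (x + 1) ^+ 2); last first.
    by field; rewrite !gt_eqF.
  by rewrite ler_wpM2l// !mulr_ge0 ?invr_ge0 ?exprn_ge0
    ?(ltW E0) ?(ltW A0) ?(ltW B0) ?(ltW x0) ?(ltW D0) ?(ltW D'0).
have h1 : x * (x + 2^-1) * (P * A) * (P * B) <= (x + l) * (x + 2^-1 + l) * A' * B'.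
  rewrite [leLHS](_ : _ = (x * (P * A)) * ((x + 2^-1) * (P * B))); last by ring.
  rewrite [leRHS](_ : _ = ((x + l) * A') * ((x + 2^-1 + l) * B')); last by ring.
  apply: ler_pM => //; rewrite ?mulr_ge0 ?(ltW P0) ?(ltW A0) ?(ltW B0) ?(ltW x0) ?(ltW h0)//.
  by apply: le_trans B2; rewrite ler_wpM2l ?(ltW h0)// ler_wpM2r ?(ltW B0).
(* Here the losses come from the lower bounds for [A'] and [B']; replacing [Q] by the smaller [P]
   costs nothing in this direction. *)
have h2 : (x + l) * (x + 2^-1 + l) / (x * (x + 2^-1)) <= ((x + 1) / x) ^+ 2.
  rewrite ler_pdivrMr ?mulr_gt0// expr_div_n [leRHS](_ : _ = (x + 1) ^+ 2 * (x + 2^-1) / x).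
    rewrite ler_pdivlMr//; nra.
  by field; rewrite gt_eqF.
have h3 : A * B * (T * P ^+ 2) <= T * ((x + 1) / x) ^+ 2 * A' * B'.
  apply: (@le_trans _ _ (T * ((x + l) * (x + 2^-1 + l) / (x * (x + 2^-1))) * (A' * B'))).
    rewrite [leRHS](_ : _ = T * ((x + l) * (x + 2^-1 + l) * A' * B') /
      (x * (x + 2^-1))); last by ring.
    rewrite ler_pdivlMr ?mulr_gt0//.
    rewrite [leLHS](_ : _ = T * (x * (x + 2^-1) * (P * A) * (P * B))); last by ring.
    by rewrite ler_wpM2l ?(ltW T0).
  rewrite [leRHS](_ : _ = T * ((x + 1) / x) ^+ 2 * (A' * B')); last by ring.
  by rewrite ler_wpM2r ?mulr_ge0 ?(ltW A'0) ?(ltW B'0)// ler_wpM2l ?(ltW T0).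
have h4 : D^-1 <= T * P ^+ 2 / D'.
  by rewrite ler_pdivlMr// mulrC ler_pdivrMr.
have c0 : 0 <= E * A * B by rewrite !mulr_ge0 ?(ltW E0) ?(ltW A0) ?(ltW B0).
apply: (le_trans (ler_wpM2l c0 h4)).
rewrite [leLHS](_ : _ = E / D' * (A * B * (T * P ^+ 2))); last by ring.
rewrite [leRHS](_ : _ = E / D' * (T * ((x + 1) / x) ^+ 2 * A' * B')); last by ring.
by rewrite ler_wpM2l// divr_ge0 ?(ltW E0) ?(ltW D'0).
Qed.

Lemma duplication_ratio_addr z l : 0 < z -> 0 <= l <= 2^-1 ->
  duplication_ratio (z + l) = duplication_ratio z.
Proof.
move=> z0 /[dup] l01 /andP[l0 _].
have dn w n : 0 < w -> duplication_ratio (w + n%:R) = duplication_ratio w.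
  move=> w0; elim: n => [|n ih]; first by rewrite addr0.
  by rewrite -natr1 addrA duplication_ratioS ?ih// ltr_wpDr.
have zl0 : 0 < z + l by rewrite ltr_wpDr.
have zn0 n : 0 < z + n%:R by rewrite ltr_wpDr.
apply/eqP; rewrite eq_le; apply/andP; split.
  suff : duplication_ratio (z + l) / duplication_ratio z <= 1.
    by rewrite ler_pdivrMr ?mul1r ?duplication_ratio_gt0.
  apply: (le1_of_sqr_ratio _ z z0) => n; rewrite ler_pdivrMr ?duplication_ratio_gt0//.
  rewrite -(dn z n)// -(dn (z + l) n)// (addrAC z l).
  exact: (duplication_ratio_addr_bounds _ _ (zn0 n) l01).1.
suff : duplication_ratio z / duplication_ratio (z + l) <= 1.
  by rewrite ler_pdivrMr ?mul1r ?duplication_ratio_gt0.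
apply: (le1_of_sqr_ratio _ z z0) => n; rewrite ler_pdivrMr ?duplication_ratio_gt0//.
rewrite -(dn z n)// -(dn (z + l) n)// (addrAC z l).
exact: (duplication_ratio_addr_bounds _ _ (zn0 n) l01).2.
Qed.

Lemma duplication_ratio_const z w : 0 < z -> 0 < w ->
  duplication_ratio z = duplication_ratio w.
Proof.
wlog zw : z w / z <= w => [H z0 w0|z0 _].
  by have [/H->//|/ltW/H ->] := leP z w.
(* Enough equal steps from [z] to [w] for each to have length at most [1/2]. *)
pose n := (Num.bound (2 * (w - z))).+1.
pose l := (w - z) / n%:R.
have l0 : 0 <= l by rewrite divr_ge0 ?subr_ge0.
have l2 : l <= 2^-1.
  rewrite ler_pdivrMr ?ltr0n//.
  have : 2 * (w - z) <= n%:R.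
    apply: ltW; apply: lt_trans (archi_boundP _) _; last by rewrite ltr_nat.
    by rewrite mulr_ge0// subr_ge0.
  lra.
have E k : duplication_ratio (z + k%:R * l) = duplication_ratio z.
  elim: k => [|k ih]; first by rewrite mul0r addr0.
  rewrite -natr1 mulrDl mul1r addrA duplication_ratio_addr ?l0// ltr_wpDr// mulr_ge0//.
by rewrite -(E n) /l mulrC divfK ?pnatr_eq0// subrKC.
Qed.

Lemma Gamma_duplication z : 0 < z ->
  2 `^ (2 * z) * Gamma z * Gamma (z + 2^-1) = 2 * Num.sqrt pi * Gamma (2 * z).
Proof.
(* The constant is read off at [1]: [2^2 * Gamma 1 * Gamma (3/2) / Gamma 2 = 2 * sqrt pi]. *)
move=> z0; have := duplication_ratio_const z 1 z0 ltr01.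
rewrite /duplication_ratio mulr1 (addrC 1) GammaS ?invr_gt0// Gamma_half Gamma1.
rewrite (_ : Gamma 2 = 1); last by rewrite -[2]natr1 GammaS// Gamma1 mulr1.
move=> /(congr1 ( *%R^~ (Gamma (2 * z)))); rewrite divfK; last first.
  by rewrite gt_eqF// Gamma_gt0// mulr_gt0.
by move=> ->; rewrite powR_mulrn//; field.
Qed.

End duplication.

(** * Mixtures of gamma densities *)

Section mixture.
Context {R : realType}.
Implicit Types (a al p s x y : R).
Local Notation mu := (@lebesgue_measure R).

(* Integrate [t^(al-1) e^(-t)] against the exponential series of [e^(ty)]. *)
Lemma negative_binomial_series al y : 0 < al -> 0 <= y < 1 ->
  (\sum_(k <oo) (Gamma (al + k%:R) / k`!%:R * y ^+ k)%:E)%E =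
  (Gamma al * (1 - y) `^ (- al))%:E.
Proof.
move=> al0 /andP[y0 y1].
have c0 k : 0 <= y ^+ k / k`!%:R by rewrite divr_ge0 ?exprn_ge0.
rewrite mulrC -egammaE ?subr_gt0// /egamma.
transitivity (\sum_(k <oo) \int[mu]_(t in `]0%R, +oo[)
   (y ^+ k / k`!%:R * (t `^ (al + k%:R - 1) * expR (- (1 * t))))%:E)%E.
  apply: eq_eseriesr => k _; rewrite -egammaZl// egamma1E ?ltr_wpDr//.
  by rewrite -EFinM; congr EFin; ring.
rewrite -integral_nneseries//; last 2 first.
- move=> k; apply/measurable_EFinP; apply: measurable_funM => //.
  exact: measurable_powR_expR.
- by move=> k x _; rewrite lee_fin mulr_ge0 // mulr_ge0 ?powR_ge0 ?expR_ge0.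
apply: eq_integral => t; rewrite inE/= in_itv/= andbT => t0.
transitivity (\sum_(k <oo) ((t `^ (al - 1) * expR (- (1 * t)))%:E *
   ((t * y) ^+ k / k`!%:R)%:E))%E.
  apply: eq_eseriesr => k _; rewrite -EFinM; congr EFin.
  rewrite addrAC (gt0_powRD t (al - 1) k%:R)// powR_mulrn ?ltW// exprMn; ring.
rewrite nneseriesZl; last first.
  by move=> k _; rewrite lee_fin divr_ge0 ?exprn_ge0 ?mulr_ge0 ?(ltW t0).
rewrite nneseries_expR -EFinM -mulrA -expRD; congr (_ * expR _)%:E.
by ring.
Qed.

(** The denominator cancels the gamma factor in the integral [p^(-s-2k) * Gamma (s + 2k)] of
    [x^(s+2k-1) e^(-px)]; what remains is [p^(-s)] times a term of [negative_binomial_series] at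
    [y = (a / p)^2]. *)
Definition mixture_coef (a al s : R) (k : nat) : R :=
  Gamma (al + k%:R) / k`!%:R * a ^+ (2 * k) / Gamma (s + 2 * k%:R).

(** Extended-real valued, so that sum and integral of nonnegative terms are interchanged without a
    convergence check. *)
Definition mixture (a al s p x : R) : \bar R :=
  (\sum_(k <oo) (mixture_coef a al s k *
     (x `^ (s + 2 * k%:R - 1) * expR (- (p * x))))%:E)%E.

Section mixture_lemmas.
Variables (a al s : R).
Hypotheses (a0 : 0 < a) (al0 : 0 < al) (s0 : 0 < s).

Lemma mixture_coef_gt0 k : 0 < mixture_coef a al s k.
Proof.
rewrite /mixture_coef divr_gt0 ?mulr_gt0 ?divr_gt0 ?Gamma_gt0 ?exprn_gt0//.
- by rewrite ltr_wpDr.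
- by rewrite ltr_wpDr// mulr_ge0.
Qed.

Lemma mixture_term_ge0 p x k :
  0 <= mixture_coef a al s k * (x `^ (s + 2 * k%:R - 1) * expR (- (p * x))).
Proof. by rewrite mulr_ge0 ?(ltW (mixture_coef_gt0 k))// mulr_ge0 ?powR_ge0 ?expR_ge0. Qed.

Lemma mixture_ge0 p x : (0 <= mixture a al s p x)%E.
Proof. by apply: nneseries_ge0 => k _ _; rewrite lee_fin mixture_term_ge0. Qed.

Lemma mixture_gt0 p x : 0 < x -> (0 < mixture a al s p x)%E.
Proof.
move=> x0; apply: lt_le_trans (nneseries_lim_ge 1 _).
  by rewrite big_mkord big_ord1 lte_fin mulr_gt0 ?mixture_coef_gt0// mulr_gt0 ?powR_gt0 ?expR_gt0.
by move=> k _; rewrite lee_fin mixture_term_ge0.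
Qed.

Lemma measurable_mixture_term p k (D : set R) : measurable_fun D (fun x =>
  (mixture_coef a al s k * (x `^ (s + 2 * k%:R - 1) * expR (- (p * x))))%:E).
Proof.
apply/measurable_EFinP; apply: measurable_funM => //.
exact: measurable_powR_expR.
Qed.

Lemma measurable_mixture p (D : set R) : measurable D ->
  measurable_fun D (mixture a al s p).
Proof.
move=> mD; apply: ge0_emeasurable_sum => // [k x _ _|k _].
  by rewrite lee_fin mixture_term_ge0.
exact: measurable_mixture_term.
Qed.

(** Exponential tilting only shifts [p], so the Laplace transform at [q] is the total mass of the
    mixture at [p + q]. *)
Lemma mixture_expR p q x :
  ((expR (- (q * x)))%:E * mixture a al s p x = mixture a al s (p + q) x)%E.
Proof.
rewrite /mixture -nneseriesZl; last first.
  by move=> k _; rewrite lee_fin mixture_term_ge0.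
apply: eq_eseriesr => k _; rewrite -EFinM; congr EFin.
rewrite (_ : - ((p + q) * x) = - (p * x) + - (q * x)); last by ring.
by rewrite expRD; ring.
Qed.

Lemma integral_mixture p : a < p ->
  (\int[mu]_(x in `]0%R, +oo[) mixture a al s p x)%E =
  (Gamma al * p `^ (- s) * (1 - (a / p) ^+ 2) `^ (- al))%:E.
Proof.
move=> ap; have p0 : 0 < p by exact: lt_trans ap.
have y01 : 0 <= (a / p) ^+ 2 < 1.
  by rewrite sqr_ge0/= expr_lt1 ?divr_ge0 ?ltW// ltr_pdivrMr ?mul1r.
rewrite integral_nneseries//; last 2 first.
- by move=> k; exact: measurable_mixture_term.
- by move=> k x _; rewrite lee_fin mixture_term_ge0.
rewrite mulrAC mulrC EFinM -negative_binomial_series// -nneseriesZl; last first.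
  move=> k _; rewrite lee_fin mulr_ge0 ?exprn_ge0 ?divr_ge0 ?sqr_ge0 ?(ltW a0) ?(ltW p0)//.
  by rewrite (ltW (Gamma_gt0 _ _))// ltr_wpDr.
apply: eq_eseriesr => k _.
have sk0 : 0 < s + 2 * k%:R by rewrite ltr_wpDr// mulr_ge0.
rewrite -egammaZl ?(ltW (mixture_coef_gt0 k))// egammaE// -!EFinM; congr EFin.
rewrite /mixture_coef opprD gt0_powRD// -natrM powR_invn ?ltW//.
rewrite -exprM expr_div_n.
have := Gamma_gt0 _ sk0; rewrite natrM; move: (Gamma (s + _)) => g g0.
by field; rewrite !gt_eqF ?ltr0n ?fact_gt0 ?exprn_gt0.
Qed.

End mixture_lemmas.
End mixture.

(** * Probability measures given by a density *)

Section density_probability.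
Context d (T : measurableType d) (R : realType)
  (mu : {sigma_finite_measure set T -> \bar R}).
Variable f : T -> \bar R.
Hypotheses (mf : measurable_fun [set: T] f) (f0 : forall x, (0 <= f x)%E)
  (f1 : (\int[mu]_x f x = 1)%E).

(* The hypotheses are arguments only so that the instances below can find them. *)
Definition density_prob of measurable_fun [set: T] f & (forall x, (0 <= f x)%E)
  & (\int[mu]_x f x = 1)%E := fun A : set T => (\int[mu]_(x in A) f x)%E.

Local Notation nu := (density_prob mf f0 f1).

Let nu0 : nu set0 = 0%E. Proof. exact: integral_set0. Qed.

Let nu_ge0 A : (0 <= nu A)%E. Proof. by apply: integral_ge0 => x _. Qed.

Let nu_sigma_additive : semi_sigma_additive nu.
Proof. exact: semi_sigma_additive_nng_induced. Qed.

HB.instance Definition _ := isMeasure.Build _ _ _ nu nu0 nu_ge0 nu_sigma_additive.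

HB.instance Definition _ := @Measure_isProbability.Build _ _ R nu f1.

Lemma density_prob_dominates : nu `<< mu.
Proof.
apply/null_content_dominatesP => A mA muA0.
apply: null_set_integral => //.
exact: measurable_funTS.
Qed.

(** Change of variables holds for the Radon-Nikodym derivative [h]; [h] and [f] have the same
    integral over every measurable subset of [D], hence agree almost everywhere there. *)
Lemma integral_density_prob (D : set T) (g : T -> \bar R) :
  measurable D -> measurable_fun D g -> (forall x, (0 <= g x)%E) ->
  (\int[nu]_(x in D) g x = \int[mu]_(x in D) (g x * f x))%E.
Proof.
move=> mD mg g0.
rewrite -(Radon_Nikodym_SigmaFinite.change_of_variables density_prob_dominates)//.
pose h := Radon_Nikodym_SigmaFinite.f nu mu.
have ih : mu.-integrable [set: T] h.
  exact/Radon_Nikodym_SigmaFinite.f_integrable/density_prob_dominates.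
apply: ae_eq_integral => //.
- apply: emeasurable_funM => //; exact/measurable_funTS/(measurable_int mu).
- apply: emeasurable_funM => //; exact/measurable_funTS.
apply: ae_eqe_mul2l; apply: integral_ae_eq => //.
- exact: integrableS ih.
- exact: measurable_funTS.
move=> E ED mE.
rewrite -(Radon_Nikodym_SigmaFinite.f_integral density_prob_dominates)//.
Qed.

End density_probability.

(** * The Bessel density and its convolution roots *)

Section bessel_density.
Context {R : realType}.
Variables (m a b : R).
Hypotheses (hm : -1 < m) (a0 : 0 < a) (ab : a < b).
Local Notation mu := (@lebesgue_measure R).

Let b0 : 0 < b. Proof. exact: lt_trans ab. Qed.

(** Since [Gamma (k + m + 1) >= (m + 1)^k * Gamma (m + 1)], the terms are dominated by a multiple of
    the exponential series at [(z / 2)^2 / (m + 1)]. *)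
Lemma is_cvg_besselI z : 0 < z -> cvgn (series (fun k : nat =>
  (z / 2) `^ (2 * k%:R + m) / (k`!%:R * Gamma (k%:R + m + 1)))).
Proof.
move=> z0; have z20 : 0 < z / 2 by rewrite divr_gt0.
have m1 : 0 < m + 1 by rewrite -[ltLHS](addNr 1) ltrD2r.
have km k : 0 < k%:R + m + 1 by rewrite -addrA ltr_wpDl.
have G k : (m + 1) ^+ k * Gamma (m + 1) <= Gamma (k%:R + m + 1).
  elim: k => [|k ih]; first by rewrite mul1r add0r.
  rewrite -natr1 (_ : k%:R + 1 + m + 1 = k%:R + m + 1 + 1); last by ring.
  rewrite (GammaS (k%:R + m + 1))// exprS -mulrA ler_pM ?mulr_ge0 ?exprn_ge0
    ?(ltW m1) ?(ltW (Gamma_gt0 _ _))//.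
  by rewrite lerD2r lerDr.
apply: (@series_le_cvg _ _ (fun k => (z / 2) `^ m / Gamma (m + 1) *
    (((z / 2) ^+ 2 / (m + 1)) ^+ k / k`!%:R))) => [k|k|k|].
- by rewrite divr_ge0 ?powR_ge0 ?mulr_ge0 ?(ltW (Gamma_gt0 _ _)).
- rewrite mulr_ge0 ?divr_ge0 ?powR_ge0 ?(ltW (Gamma_gt0 _ _)) ?exprn_ge0//.
  by rewrite divr_ge0 ?sqr_ge0 ?(ltW m1).
- rewrite gt0_powRD// -natrM powR_mulrn ?(ltW z20)// exprM.
  rewrite ler_pdivrMr ?mulr_gt0 ?Gamma_gt0// ?ltr0n ?fact_gt0//.
  rewrite [leRHS](_ : _ = (z / 2) `^ m * (z / 2) ^+ 2 ^+ k *
    (Gamma (k%:R + m + 1) / ((m + 1) ^+ k * Gamma (m + 1)))); last first.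
    rewrite expr_div_n.
    have : k`!%:R != 0 :> R by rewrite pnatr_eq0 -lt0n fact_gt0.
    have := Gamma_gt0 _ m1; have := exprn_gt0 k m1.
    move: (Gamma _) (Gamma _) ((m + 1) ^+ k) (k`!%:R : R) => g1 g2 p1 p2 h1 h2 h3.
    by field; rewrite h3 !gt_eqF.
  rewrite mulrC ler_peMr ?mulr_ge0 ?powR_ge0 ?exprn_ge0 ?(ltW z20)//.
  by rewrite ler_pdivlMr ?mul1r ?mulr_gt0 ?exprn_gt0 ?Gamma_gt0.
apply: is_cvg_seriesZ; exact: is_cvg_series_exp_coeff.
Qed.

Let al c := c * (m + 3 / 2).
Let s c := c * (2 * m + 2).

(** The reciprocal of the mass given by [integral_mixture] at [p = b]. *)
Definition norm_cst c : R :=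
  b `^ (s c) * (1 - (a / b) ^+ 2) `^ (al c) / Gamma (al c).

(* [c] is the exponent of the Laplace transform: [c = 1] gives [psi] and
   [c = 1 / n] its [n]-th convolution root. *)
Definition bessel_density c : R -> \bar R :=
  (fun x => (norm_cst c)%:E * mixture a (al c) (s c) b x)%E \_ `]0, +oo[.

Section param.
Variable c : R.
Hypothesis c0 : 0 < c.

Let al0 : 0 < al c. Proof. by rewrite /al mulr_gt0//; move: hm; lra. Qed.

Let s0 : 0 < s c. Proof. by rewrite /s mulr_gt0//; move: hm; lra. Qed.

Let one_sub_gt0 p : a < p -> 0 < 1 - (a / p) ^+ 2.
Proof.
move=> ap; rewrite subr_gt0 expr_lt1 ?divr_ge0 ?(ltW a0) ?(ltW (lt_trans a0 ap))//.
by rewrite ltr_pdivrMr ?mul1r// (lt_trans a0).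
Qed.

Lemma norm_cst_gt0 : 0 < norm_cst c.
Proof. by rewrite divr_gt0 ?mulr_gt0 ?powR_gt0 ?Gamma_gt0 ?one_sub_gt0. Qed.

Lemma bessel_density_ge0 x : (0 <= bessel_density c x)%E.
Proof.
apply: erestrict_ge0 => y _; rewrite mule_ge0 ?mixture_ge0// lee_fin.
exact/ltW/norm_cst_gt0.
Qed.

Lemma bessel_densityE x : 0 < x ->
  bessel_density c x = ((norm_cst c)%:E * mixture a (al c) (s c) b x)%E.
Proof. by move=> x0; rewrite /bessel_density patchE mem_set//= in_itv/= x0. Qed.

Lemma bessel_density0 x : x <= 0 -> bessel_density c x = 0%E.
Proof.
move=> x0; rewrite /bessel_density patchE memNset//= in_itv/= andbT.
by apply/negP; rewrite -leNgt.
Qed.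

Lemma bessel_density_gt0 x : 0 < x -> (0 < bessel_density c x)%E.
Proof.
by move=> x0; rewrite bessel_densityE// mule_gt0 ?mixture_gt0// lte_fin norm_cst_gt0.
Qed.

Lemma measurable_bessel_density : measurable_fun [set: R] (bessel_density c).
Proof.
apply/(measurable_restrictT _ _).1 => //.
by apply: measurable_funeM; exact: measurable_mixture.
Qed.

(** The Laplace transform for [c = 1], kept as a product of two powers so that raising it to the
    power [c] turns the exponents into [s c] and [al c]. *)
Definition laplace_base x : R := (b / (b + x)) `^ (2 * m + 2) *
  ((1 - (a / b) ^+ 2) / (1 - (a / (b + x)) ^+ 2)) `^ (m + 3 / 2).

(** The value [x = 0] is included because it yields the total mass. *)
Lemma integral_expR_bessel_density x : 0 <= x ->
  (\int[mu]_(t in `[0%R, +oo[) ((expR (- (x * t)))%:E * bessel_density c t) =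
  (laplace_base x `^ c)%:E)%E.
Proof.
move=> x0; have abx : a < b + x by rewrite ltr_wpDr.
have bx0 : 0 < b + x by exact: lt_trans abx.
rewrite -integral_itv_obnd_cbnd; last first.
  apply: emeasurable_funM; last first.
    apply: (measurable_funTS measurable_bessel_density).
  by apply/measurable_EFinP; exact: measurable_expRM.
transitivity (\int[mu]_(t in `]0%R, +oo[)
    ((norm_cst c)%:E * mixture a (al c) (s c) (b + x) t))%E.
  apply: eq_integral => t; rewrite inE/= in_itv/= andbT => t0.
  by rewrite bessel_densityE// muleCA mixture_expR.
rewrite ge0_integralZl//; last 3 first.
- exact: measurable_mixture.
- by move=> t _; exact: mixture_ge0.
- by rewrite lee_fin ltW// norm_cst_gt0.
rewrite integral_mixture// -EFinM; congr EFin.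
rewrite /norm_cst /laplace_base [RHS]powRM ?powR_ge0// -!powRrM (mulrC _ c) (mulrC _ c).
have q0 := one_sub_gt0 _ abx; have q1 := one_sub_gt0 _ ab.
rewrite -/(al c) -/(s c) !powRN !powRM ?invr_ge0 ?powRV ?(ltW q0) ?(ltW q1) ?(ltW b0) ?(ltW bx0)//.
have := Gamma_gt0 _ al0; have := powR_gt0 (s c) bx0; have := powR_gt0 (al c) q0.
move: (Gamma _) (_ `^ _) (_ `^ _) => g u v u0 v0 g0.
by field; rewrite !gt_eqF.
Qed.

Lemma integral_bessel_density : (\int[mu]_x bessel_density c x = 1)%E.
Proof.
transitivity (\int[mu]_(t in `[0%R, +oo[)
    ((expR (- (0 * t)))%:E * bessel_density c t))%E; last first.
  rewrite integral_expR_bessel_density// /laplace_base addr0.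
  by rewrite !divff ?gt_eqF ?one_sub_gt0// !powR1 mul1r powR1.
rewrite [RHS]integral_mkcond; apply: eq_integral => x _.
rewrite patchE; case: ifPn => [_|]; first by rewrite mul0r oppr0 expR0 mul1e.
rewrite notin_setE/= in_itv/= andbT => /negP; rewrite -ltNge => x0.
by rewrite bessel_density0// ltW.
Qed.

Definition bessel_prob : probability (measurableTypeR R) R :=
  density_prob _ _ _ mu (bessel_density c) measurable_bessel_density
    bessel_density_ge0 integral_bessel_density.

Lemma bessel_prob_on_nonneg : on_nonneg bessel_prob.
Proof.
rewrite /on_nonneg -integral_bessel_density.
rewrite [RHS](_ : _ = \int[mu]_(x in `[0%R, +oo[) bessel_density c x)%E//.
rewrite [RHS]integral_mkcond; apply: eq_integral => x _.
rewrite patchE; case: ifPn => //.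
rewrite notin_setE/= in_itv/= andbT => /negP; rewrite -ltNge => x0.
by rewrite bessel_density0// ltW.
Qed.

Lemma laplace_bessel_prob x : 0 < x -> laplace bessel_prob x = laplace_base x `^ c.
Proof.
move=> x0; rewrite /laplace /Rintegral.
rewrite integral_density_prob//.
- by rewrite integral_expR_bessel_density ?(ltW x0).
- by apply/measurable_EFinP; exact: measurable_expRM.
Qed.

Lemma msupport_bessel_prob : msupport bessel_prob = `[0, +oo[%classic.
Proof.
apply/seteqP; split => [x xsupp|x] /=; rewrite in_itv/= andbT.
  rewrite leNgt; apply/negP => x0.
  have oN : open `]-oo, (0 : R)[%classic by exact: interval_open.
  have := xsupp _ oN; rewrite /= in_itv/= => /(_ x0).
  rewrite [X in (_ < X)%E -> _](_ : _ = 0%E) ?ltxx//.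
  by apply: integral0_eq => y /=; rewrite in_itv/= => y0; rewrite bessel_density0// ltW.
move=> x0 U oU Ux.
have [e /= e0 xeU] : nbhs x U by exact: open_nbhs_nbhs.
(* Only the right half of the ball is used: it lies in []0, +oo[] even when [x = 0]. *)
apply: (@integral_gt0_itv _ (bessel_density c) U x (x + e)).
- exact: open_measurable.
- exact: (measurable_funTS measurable_bessel_density).
- by move=> y _; exact: bessel_density_ge0.
- by rewrite ltrDl.
- move=> y /=; rewrite in_itv/= => /andP[xy yxe]; apply: xeU => /=.
  by rewrite ltr_distlC; apply/andP; split; lra.
- move=> y; rewrite in_itv/= => /andP[xy _].
  by rewrite bessel_density_gt0// (le_lt_trans x0).
Qed.

End param.

(** The two series agree term by term: duplication at [k + m + 1] expresses [Gamma (m + 3/2 + k)]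
    through [Gamma (2m + 2 + 2k)] and [Gamma (k + m + 1)], and the former cancels the denominator of
    [mixture_coef]. *)
Lemma bessel_density1E x : 0 < x -> bessel_density 1 x = (psi m a b x)%:E.
Proof.
move=> x0; rewrite bessel_densityE// /psi /besselI.
have ax0 : 0 < a * x by rewrite mulr_gt0.
rewrite [RHS]EFinM -nneseries_limn; last exact: is_cvg_besselI.
have m1 : 0 < m + 1 by rewrite -[ltLHS](addNr 1) ltrD2r.
have km k : 0 < k%:R + m + 1 by rewrite -addrA ltr_wpDl.
rewrite -!nneseriesZl; last 2 first.
- by move=> k _; rewrite lee_fin mixture_term_ge0// /al /s mul1r; move: hm; lra.
- by move=> k _; rewrite lee_fin divr_ge0 ?powR_ge0 ?mulr_ge0 ?(ltW (Gamma_gt0 _ _))//.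
apply: eq_eseriesr => k _; rewrite -!EFinM; congr EFin.
rewrite /norm_cst /mixture_coef /al /s !mul1r.
(* The [1 / b] in the constant of [psi] is the gap between the exponents [2m + 2] and
   [2 * (m + 3/2) = 2m + 3] of [b]. *)
have hb : b `^ (2 * m + 2) * (1 - (a / b) ^+ 2) `^ (m + 3 / 2) =
    (b ^+ 2 - a ^+ 2) `^ (m + 3 / 2) / b.
  have -> : 1 - (a / b) ^+ 2 = (b ^+ 2 - a ^+ 2) * (b ^+ 2)^-1.
    by field; rewrite gt_eqF.
  rewrite powRM ?invr_ge0 ?sqr_ge0 ?subr_ge0 ?ler_pXn2r ?nnegrE ?(ltW a0) ?(ltW b0) ?(ltW ab)//.
  rewrite powRV ?exprn_gt0// -[b ^+ 2]powR_mulrn ?(ltW b0)// -[(b `^ 2) `^ _]powRrM.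
  rewrite (_ : 2 * (m + 3 / 2) = 2 * m + 2 + 1); last by field.
  rewrite (gt0_powRD b (2 * m + 2) 1)// powRr1 ?(ltW b0)//.
  by field; rewrite !gt_eqF ?powR_gt0.
have hx : x `^ (2 * m + 2 + 2 * k%:R - 1) = x `^ (m + 1) * x `^ m * x ^+ (2 * k).
  rewrite (_ : _ - 1 = m + 1 + m + 2 * k%:R); last by ring.
  by rewrite !(gt0_powRD x)// -natrM powR_mulrn ?(ltW x0).
have h2 : 2 `^ (2 * m + 2 + 2 * k%:R) = (2 `^ m) ^+ 2 * 4 * 2 ^+ (2 * k) :> R.
  rewrite (gt0_powRD 2 (2 * m + 2))// (gt0_powRD 2 (2 * m))// -natrM !powR_mulrn//.
  rewrite -[in RHS]powR_mulrn ?powR_ge0// -powRrM (mulrC m).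
  by congr (_ * _ * _); ring.
have hz : (a * x / 2) `^ (2 * k%:R + m) = a ^+ (2 * k) * x ^+ (2 * k) / 2 ^+ (2 * k) *
    (a `^ m * x `^ m / 2 `^ m).
  rewrite gt0_powRD ?divr_gt0// -natrM powR_mulrn ?divr_ge0 ?(ltW ax0)//.
  by rewrite expr_div_n exprMn !powRM ?invr_ge0 ?(ltW ax0) ?(ltW a0) ?(ltW x0)// powRV.
have := Gamma_duplication _ (km k).
rewrite (_ : k%:R + m + 1 + 2^-1 = m + 3 / 2 + k%:R); last by field.
rewrite (_ : 2 * (k%:R + m + 1) = 2 * m + 2 + 2 * k%:R); last by ring.
rewrite hb hx h2 hz powRM ?(ltW a0)//.
have F0 : k`!%:R != 0 :> R by rewrite pnatr_eq0 -lt0n fact_gt0.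
have N0 : 2 ^+ (2 * k) != 0 :> R by rewrite expf_neq0.
have T0 : 2 `^ m != 0 :> R by rewrite gt_eqF// powR_gt0.
have A0 : a `^ m != 0 :> R by rewrite gt_eqF// powR_gt0.
have g10 : Gamma (k%:R + m + 1) != 0 by rewrite gt_eqF// Gamma_gt0.
have g20 : Gamma (2 * m + 2 + 2 * k%:R) != 0.
  by rewrite gt_eqF// Gamma_gt0// ltr_wpDr ?mulr_ge0//; move: hm; lra.
have G0 : Gamma (m + 3 / 2) != 0 by rewrite gt_eqF// Gamma_gt0//; move: hm; lra.
have bN0 : b != 0 by rewrite gt_eqF.
move: F0 N0 T0 A0 g10 g20 G0.
move: (Gamma (k%:R + m + 1)) (Gamma (m + 3 / 2 + k%:R))
  (Gamma (2 * m + 2 + 2 * k%:R)) (Gamma (m + 3 / 2)) (k`!%:R : R)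
  (2 ^+ (2 * k) : R) (2 `^ m) (a `^ m).
move=> g1 g3 g2 G F N T A F0 N0 T0 A0 g10 g20 G0 dupE.
have -> : g3 = 2 * Num.sqrt pi * g2 / (T ^+ 2 * 4 * N * g1).
  by rewrite -dupE; field; rewrite g10 N0 T0.
by field; rewrite g10 N0 T0 F0 G0 A0 bN0.
Qed.

End bessel_density.

Theorem theorem2 (R : realType) (mu a b : R)
    (hmu : -1 < mu) (ha : 0 < a) (hab : a < b) :
  exists nu : probability (measurableTypeR R) R,
    [/\ has_pdf nu (fun x : R => if 0 < x then psi mu a b x else 0),
        msupport nu = `[0, +oo[%classic &
        infinitely_divisible nu].
Proof.
have pdfE x : ((if 0 < x then psi mu a b x else 0)%:E = bessel_density mu a b 1 x)%E.
  case: ltP => x0; first by rewrite bessel_density1E.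
  by rewrite bessel_density0.
exists (bessel_prob mu a b hmu ha hab 1 ltr01); split.
- split.
  + apply/measurable_EFinP.
    rewrite (_ : EFin \o _ = bessel_density mu a b 1); last exact/funext.
    exact: measurable_bessel_density.
  + by move=> x; rewrite -lee_fin pdfE bessel_density_ge0.
  + by move=> A mA; under eq_integral do rewrite pdfE.
- exact: msupport_bessel_prob.
- split; first exact: bessel_prob_on_nonneg.
  move=> n n0; have nV0 : 0 < n%:R^-1 :> R by rewrite invr_gt0 ltr0n.
  exists (bessel_prob mu a b hmu ha hab n%:R^-1 nV0).
  split; first exact: bessel_prob_on_nonneg.
  move=> x x0; rewrite !laplace_bessel_prob// -powR_mulrn ?powR_ge0//.
  by rewrite -powRrM mulVf ?pnatr_eq0 -?lt0n.
Qed.
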